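(* Let $1/q$ be a prime power, $\Bbbk=\mathbb{F}_{1/q}$, $\alpha$ a weak composition of $n$, $\lambda\vdash n$, and $T$ a semistandard tableau of shape $\lambda$ and content $\alpha$. Then the number of pairs $(F,N)$ with $F\in\mathrm{Fl}_\alpha$, $N\in\mathfrak{gl}_n(\Bbbk)$ strictly compatible with $F$, and $\mathrm{JF}(N;F)=T$ equals $$\frac{q^{-n^2+n+n(\lambda)+n(\alpha)}(1-q)^{n-\lambda_1}[n]_q!}{\prod_{i\ge1}[\lambda_i-\lambda_{i+1}]_q!}\,\mathrm{wt}_q(T).$$
   Context: $n(\alpha)=\sum\binom{\alpha_i}2$; $[m]_q!=\prod_{r\le m}(1+\cdots+q^{r-1})$; $\binom{m}{r}_q=[m]_q!/([r]_q![m-r]_q!)$. $\mathrm{Fl}_\alpha$: chains $0=F_0\subseteq\cdots\subseteq F_k=\Bbbk^n$ with $\dim F_i=\alpha_1+\cdots+\alpha_i$. $N$ strictly compatible with $F$: $N(F_i)\subseteq F_{i-1}$ for $i\ge1$; then $\mathrm{JF}(N;F)$ is the semistandard tableau whose entries $\le i$ form the shape $\mathrm{JF}(N|_{F_i})$, where for nilpotent $N$, $\mathrm{JF}(N)$ is the partition with $\lambda_1+\cdots+\lambda_i=\dim\ker N^i$. $\mathrm{wt}_q(T)=\prod_{i,j\ge1}\binom{T^{(j)}_i-T^{(j)}_{i+1}}{T^{(j)}_i-T^{(j-1)}_i}_q$ with $T^{(j)}$ the shape of entries $\le j$. (Such pairs $(F,N)$ are exactly the points of a type-$A$ Nakajima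 quiver variety whose socle filtration corresponds to $T$.) *)

(* Defs.v *)
From HB Require Import structures.
From mathcomp Require Import all_boot all_order all_algebra.
Set Implicit Arguments. Unset Strict Implicit. Unset Printing Implicit Defensive.
Import Order.TTheory GRing.Theory Num.Theory.

(* Vectors are row vectors in 'rV[F]_n; a subspace is represented by its
   canonical matrix (genmx), so distinct subspaces are distinct matrices.
   A flag of type alpha (k = size alpha parts) is V : 'I_(k+1) -> 'M_n with
   V i canonical, dim V i = alpha_1 + ... + alpha_i, V i <= V (i+1).
   N acts on row vectors on the right: v |-> v *m N. *)

Definition is_flag (F : fieldType) (n : nat) (alpha : seq nat)
    (V : {ffun 'I_(size alpha).+1 -> 'M[F]_n}) : bool :=
  [forall i : 'I_(size alpha).+1,
     (V i == genmx (V i)) && (\rank (V i) == sumn (take i alpha))]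
  && [forall i : 'I_(size alpha), (V (inord i) <= V (inord i.+1))%MS].

Definition strictly_compatible (F : fieldType) (n : nat) (alpha : seq nat)
    (V : {ffun 'I_(size alpha).+1 -> 'M[F]_n}) (N : 'M[F]_n) : bool :=
  [forall i : 'I_(size alpha), ((V (inord i.+1) *m N)%R <= V (inord i))%MS].

Definition dimker_restr (F : fieldType) (n : nat) (W N : 'M[F]_n) (m : nat) : nat :=
  \rank (W :&: kermx (N ^+ m))%MS.

(* The m-th part (m >= 1) of JF(N|_W): lambda_1+...+lambda_m = dim ker (N|_W)^m. *)
Definition jfpart (F : fieldType) (n : nat) (W N : 'M[F]_n) (m : nat) : nat :=
  dimker_restr W N m - dimker_restr W N m.-1.

Definition is_partition (la : seq nat) : bool :=
  sorted geq la && all (fun x => 0 < x) la.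

Definition is_ssyt (T : seq (seq nat)) (la alpha : seq nat) : bool :=
  [&& map size T == la,
      all (fun r => sorted leq r) T,
      all (fun r => all (fun c => nth 0 (nth [::] T r) c < nth 0 (nth [::] T r.+1) c)
                        (iota 0 (size (nth [::] T r.+1))))
          (iota 0 (size T)),
      all (fun x => (0 < x) && (x <= size alpha)) (flatten T)
    & all (fun i => count_mem i.+1 (flatten T) == nth 0 alpha i) (iota 0 (size alpha))].

(* T^{(j)}_i (i >= 1): length of the i-th row of the shape of entries <= j *)
Definition tshape (T : seq (seq nat)) (j i : nat) : nat :=
  count (fun x => x <= j) (nth [::] T i.-1).

(* JF(N;F) = T : for every i, JF(N|_{F_i}) = T^{(i)} (compared on parts 1..n,
   all later parts of both partitions being 0). *)
Definition JF_eq (F : fieldType) (n : nat) (alpha : seq nat)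
    (V : {ffun 'I_(size alpha).+1 -> 'M[F]_n}) (N : 'M[F]_n)
    (T : seq (seq nat)) : bool :=
  [forall i : 'I_(size alpha).+1, forall m : 'I_n,
     jfpart (V i) N m.+1 == tshape T i m.+1].

Definition count_pairs (F : finFieldType) (n : nat) (alpha : seq nat)
    (T : seq (seq nat)) : nat :=
  #|[set p : {ffun 'I_(size alpha).+1 -> 'M[F]_n} * 'M[F]_n |
      [&& is_flag p.1, strictly_compatible p.1 p.2 & JF_eq p.1 p.2 T]]|.

Local Open Scope ring_scope.

Definition nstat (a : seq nat) : nat := (\sum_(x <- a) 'C(x, 2))%N.

Definition qint (q : rat) (r : nat) : rat := \sum_(i < r) q ^+ i.
Definition qfact (q : rat) (m : nat) : rat := \prod_(1 <= r < m.+1) qint q r.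
Definition qbinom (q : rat) (m r : nat) : rat :=
  qfact q m / (qfact q r * qfact q (m - r)).

(* wt_q(T); factors with j > size alpha or i > n are all equal to 1. *)
Definition wt (q : rat) (T : seq (seq nat)) (k n : nat) : rat :=
  \prod_(1 <= j < k.+1) \prod_(1 <= i < n.+1)
     qbinom q (tshape T j i - tshape T j i.+1) (tshape T j i - tshape T j.-1 i).

Definition formula (q : rat) (n : nat) (la alpha : seq nat) (T : seq (seq nat)) : rat :=
  q ^ (- (n * n)%N%:Z + (n + nstat la + nstat alpha)%N%:Z)
  * (1 - q) ^+ (n - nth 0 la 0)
  * qfact q n / (\prod_(i < n) qfact q (nth 0 la i - nth 0 la i.+1))
  * wt q T (size alpha) n.

(* Main.v *)
Require Import Defs.
From mathcomp Require Import all_boot all_order all_algebra.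
From mathcomp Require Import mxabelem zify ring.
Import Order.TTheory GRing.Theory Num.Theory.
Local Open Scope ring_scope.
Set Implicit Arguments. Unset Strict Implicit. Unset Printing Implicit Defensive.

(* Let [Q = 1/q] be the size of the field, let [E_s] be the span of the first
   [s] basis vectors, and write [std] for the flag made of the [E_s] with [s] a
   partial sum of [alpha].

   Counting triples (flag [V], matrix [N], invertible [g] with [V = std g])
   in two ways reduces the problem to the standard flag: the number of pairs
   times the number of frames adapted to a given flag is [|GL_n(F)|] times the
   number of [N] with [JF(N; std) = T].

   The latter is computed by choosing the rows of [N] one at a time.  Suppose
   the rows of [N] of index below [r] are known and the next row [v] has to be
   taken in [E_s].  The ranks of the [N^i] on [E_(r+1)] exceed those on [E_r] by
   one exactly for the [i] up to the least [i] with [v N^i] in [E_r N^(i+1)], so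
   the shape grows by one box in row [i]; since
   [dim {v in E_s | v N^i in E_r N^(i+1)}] only depends on the shapes on [E_r]
   and [E_s], so does the number of such [v].  The sum over all the ways to fill
   a block telescopes and gives a product over the rows of the shape, which the
   Gaussian binomials of [wt] match up to a power of [Q]; this power is itself a
   difference between consecutive shapes, and the product over the blocks
   collapses to the stated formula. *)

(** * Matrices built up row by row *)

Section RowCount.
Variables (F : finFieldType) (n : nat).
Implicit Types (N A B : 'M[F]_n) (v : 'rV[F]_n).
Local Notation E := (@pid_mx F n n).

Lemma rank_adds_row m (A : 'M[F]_(m, n)) v :
  \rank (A + v)%MS = (\rank A + ~~ (v <= A)%MS)%N.
Proof.
have [vA|vA] := boolP (v <= A)%MS.
  by rewrite addn0; apply/eqmx_rank; apply/andP; rewrite addsmxSl addsmx_sub submx_refl vA.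
have lt : (A < A + v)%MS.
  by rewrite /ltmx addsmxSl addsmx_sub submx_refl (negPf vA).
have := rank_ltmx lt; have := (mxrank_adds_leqif A v).1.
have := rank_leq_row v; lia.
Qed.

Lemma card_submx m (A : 'M[F]_(m, n)) :
  #|[set v : 'rV[F]_n | (v <= A)%MS]| = (#|F| ^ \rank A)%N.
Proof. by rewrite -card_rowg; apply: eq_card => v; rewrite !inE. Qed.

Lemma pid_mxS (o : 'I_n) :
  E o.+1 = E o + (delta_mx o 0 : 'cV[F]_n) *m delta_mx 0 o :> 'M[F]_n.
Proof.
rewrite mul_delta_mx; apply/matrixP => i j; rewrite !mxE -natrD; congr _%:R.
by rewrite -!val_eqE /=; case: (i =P j :> nat); lia.
Qed.

Lemma pid_mul_delta r (o : 'I_n) : (r <= o)%N ->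
  E r *m (delta_mx o 0 : 'cV[F]_n) = 0.
Proof.
move=> ro; rewrite -colE; apply/matrixP=> i j; rewrite !mxE.
by case: (i =P o :> nat) => //= ->; rewrite ltnNge ro.
Qed.

Lemma pid_mul_delta_id r (o : 'I_n) : (o < r)%N ->
  E r *m (delta_mx o 0 : 'cV[F]_n) = delta_mx o 0.
Proof.
move=> ro; rewrite -colE; apply/matrixP=> i j; rewrite !mxE ord1 eqxx andbT.
by rewrite -val_eqE /=; case: (i =P o :> nat) => //= ->; rewrite ro.
Qed.

Lemma row_pid r (o : 'I_n) : (r <= o)%N -> row o (E r) = 0.
Proof.
move=> ro; apply/matrixP=> i j; rewrite !mxE.
by rewrite [(o < r)%N]ltnNge ro andbF.
Qed.

Lemma pid_pid r s : (r <= s)%N -> E r *m E s = E r :> 'M[F]_n.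
Proof.
move=> rs; rewrite mul_pid_mx; apply/matrixP=> i j; rewrite !mxE; congr _%:R.
by have := ltn_ord i; lia.
Qed.

Lemma pid_pid_ge r s : (s <= r)%N -> E r *m E s = E s :> 'M[F]_n.
Proof.
move=> rs; rewrite mul_pid_mx; apply/matrixP=> i j; rewrite !mxE; congr _%:R.
by have := ltn_ord i; lia.
Qed.

Lemma pid_sub r s : (r <= s)%N -> (E r <= E s)%MS.
Proof. by move=> rs; rewrite -(pid_pid rs) submxMl. Qed.

Lemma rank_pid r : (r <= n)%N -> \rank (E r) = r.
Proof. by move=> rn; rewrite rank_pid_mx. Qed.

Lemma pid_addrow (o : 'I_n) N0 v s : (s <= o)%N ->
  E s *m (N0 + delta_mx o 0 *m v) = E s *m N0.
Proof. by move=> so; rewrite mulmxDr mulmxA pid_mul_delta // mul0mx addr0. Qed.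

Lemma row_addrow (o : 'I_n) N0 v : E o *m N0 = N0 ->
  row o (N0 + delta_mx o 0 *m v) = v.
Proof.
move=> <-; rewrite linearD /= row_mul row_pid // mul0mx add0r.
by rewrite row_mul; apply/rowP => j; rewrite !mxE big_ord1 !mxE !eqxx mul1r.
Qed.

Lemma addrow_pidS (o : 'I_n) N0 v : E o *m N0 = N0 ->
  E o.+1 *m (N0 + delta_mx o 0 *m v) = N0 + delta_mx o 0 *m v.
Proof.
move=> h; rewrite mulmxDr mulmxA pid_mul_delta_id // -{1}h mulmxA.
by rewrite pid_pid_ge // h.
Qed.

Lemma eqmx_addrow (o : 'I_n) N0 v : E o *m N0 = N0 ->
  ((N0 + delta_mx o 0 *m v)%R :=: N0 + v)%MS.
Proof.
move=> h; apply/eqmxP/andP; split.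
  by apply: addmx_sub_adds; rewrite ?submx_refl ?submxMl.
rewrite addsmx_sub -{1}h -(pid_addrow N0 v (leqnn o)) submxMl /=.
by rewrite -{1}(row_addrow v h) row_sub.
Qed.

(** The condition [E r *m N = N] encodes an r by n matrix as a square one with zero rows below. Such
    a matrix with [o+1] rows is its truncation [E o *m N] together with its row [o], so the count
    splits into fibres of truncation. *)
Lemma card_addrow (o : 'I_n) (P : pred 'M[F]_n) :
  #|[set N | (E o.+1 *m N == N) && P N]| =
  (\sum_(N0 : 'M[F]_n | E o *m N0 == N0)
     #|[set v : 'rV[F]_n | P (N0 + delta_mx o 0 *m v)%R]|)%N.
Proof.
rewrite -sum1_card.
rewrite (partition_big (fun N => E o *m N) (fun N0 => E o *m N0 == N0)) /=;
  last by move=> N _; rewrite mulmxA pid_pid.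
apply: eq_bigr => N0 /eqP hN0; rewrite -sum1_card.
rewrite (reindex_onto (fun v => N0 + delta_mx o 0 *m v) (fun N => row o N)) /=.
  apply: eq_bigl => v; rewrite !inE addrow_pidS // eqxx /=.
  by rewrite pid_addrow // hN0 eqxx row_addrow // eqxx !andbT.
move=> N; rewrite inE => /andP[/andP[/eqP hN _] /eqP h].
by rewrite -[RHS]hN pid_mxS mulmxDl h -mulmxA -rowE.
Qed.

End RowCount.

(** * Counting frames of subspaces *)

Section FrameCount.
Variables (F : finFieldType) (n : nat).
Implicit Types (N g V : 'M[F]_n) (v : 'rV[F]_n).
Local Notation E := (@pid_mx F n n).

Lemma addrow_sub (o : 'I_n) N0 v V : E o *m N0 = N0 ->
  ((N0 + delta_mx o 0 *m v)%R <= V)%MS = (N0 <= V)%MS && (v <= V)%MS.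
Proof. by move=> h; rewrite (eqmx_addrow v h) addsmx_sub. Qed.

Lemma rank_addrow (o : 'I_n) N0 v : E o *m N0 = N0 ->
  \rank (N0 + delta_mx o 0 *m v)%R = (\rank N0 + ~~ (v <= N0)%MS)%N.
Proof. by move=> h; rewrite (eqmx_addrow v h) rank_adds_row. Qed.

Lemma card_sub_notsub V N : (N <= V)%MS ->
  #|[set v : 'rV[F]_n | (v <= V)%MS && ~~ (v <= N)%MS]| =
  (#|F| ^ \rank V - #|F| ^ \rank N)%N.
Proof.
move=> NV; rewrite -!card_submx.
rewrite -(cardsID [set v : 'rV[F]_n | (v <= N)%MS] [set v | (v <= V)%MS]).
have -> : [set v : 'rV[F]_n | (v <= V)%MS] :&: [set v | (v <= N)%MS] =
          [set v | (v <= N)%MS].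
  by apply/setP=> v; rewrite !inE andb_idl // => /submx_trans; apply.
by rewrite addnC addnK; apply: eq_card => v; rewrite !inE andbC.
Qed.

(* [Z] is a set of frames of an s-dimensional subspace (stored in the first s
   rows of a square matrix); [frame_ext Z s r V] are their extensions by rows in
   [V] to frames of r-dimensional subspaces. *)
Definition frame_ext (Z : {set 'M[F]_n}) (s r : nat) V : {set 'M[F]_n} :=
  [set g | (E r *m g == g) && [&& E s *m g \in Z, (g <= V)%MS & \rank g == r]].

(** The rows are added one at a time: the row of index [i] has to avoid the span of the previous
    ones, which has [#|F| ^ i] elements. *)
Lemma card_frame_ext (Z : {set 'M[F]_n}) (s r : nat) V :
    (s <= r <= n)%N ->
    (forall g, g \in Z -> [/\ E s *m g = g, (g <= V)%MS & \rank g = s]) ->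
  #|frame_ext Z s r V| = (#|Z| * \prod_(s <= i < r) (#|F| ^ \rank V - #|F| ^ i))%N.
Proof.
move=> /andP[/subnKC <- rn] hZ; elim: (r - s)%N rn => [|d IH].
  rewrite addn0 big_geq // muln1 => _.
  apply: eq_card => g; rewrite !inE; apply/idP/idP => [/and4P[/eqP ->]//|].
  by move=> gZ; have [-> -> ->] := hZ _ gZ; rewrite gZ !eqxx.
rewrite addnS => rn; rewrite big_nat_recr ?leq_addr //= mulnA -(IH (ltnW rn)) {IH}.
move: (s + d)%N (leq_addr d s) rn => {d} {}r sr rn.
rewrite (@card_addrow _ _ (Ordinal rn) (fun g => [&& E s *m g \in Z, (g <= V)%MS & \rank g == r.+1])) /=.
rewrite -sum_nat_const big_mkcond [RHS]big_mkcond /=; apply: eq_bigr => N0 _.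
rewrite inE; case: eqP => //= hN0.
(* One row raises the rank by at most one, so with this bound a final rank [r+1] forces [N0] to have
   rank exactly [r]. *)
have rN0 : (\rank N0 <= r)%N.
  by rewrite -hN0 (leq_trans (mxrankM_maxl _ _)) // rank_pid ?(ltnW rn).
case: ifP => [/and3P[N0Z N0V /eqP rkN0]|hneg].
  rewrite -[X in (_ - _ ^ X)%N]rkN0 -card_sub_notsub //; apply: eq_card => v; rewrite !inE.
  rewrite pid_addrow //= N0Z addrow_sub // N0V rank_addrow //= rkN0.
  by case: (v <= N0)%MS => /=; rewrite ?addn0 ?addn1 ?eqxx // ?andbT // ltn_eqF.
apply/eqP; rewrite cards_eq0; apply/eqP/setP => v; rewrite !inE.
apply: contraFF hneg; rewrite pid_addrow // addrow_sub // rank_addrow //.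
case/and3P=> -> /andP[-> _] /eqP; rewrite /=.
by case: (~~ _); move: rN0; lia.
Qed.

Lemma card_unitmx : #|[set g : 'M[F]_n | g \in unitmx]| =
  (\prod_(0 <= i < n) (#|F| ^ n - #|F| ^ i))%N.
Proof.
have := @card_frame_ext [set 0] 0 n 1%:M (leqnn n).
rewrite cards1 mul1n mxrank1 => <-.
  apply: eq_card => g; rewrite !inE pid_mx_0 pid_mx_1 mul0mx mul1mx !eqxx submx1.
  by rewrite -row_full_unit.
move=> g /set1P ->; split; rewrite ?mulmx0 ?sub0mx ?mxrank0 //.
Qed.

End FrameCount.

(** * The effect of one new row on the ranks of powers *)

Section Extensions.
Variables (F : finFieldType) (n : nat).
Implicit Types (N A B S W : 'M[F]_n) (v : 'rV[F]_n).
Local Notation E := (@pid_mx F n n).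

Lemma mulmx_expr_eq W A B i :
  (W *m A <= W)%MS -> W *m A = W *m B -> W *m A ^+ i = W *m B ^+ i.
Proof.
move=> /submxP[D WA] WAB; elim: i => [|i IH]; first by rewrite !expr0.
by rewrite !exprS -!mulmxE !mulmxA -WAB WA -!mulmxA IH.
Qed.

(** The set is the subspace [A + K] with [K] the kernel of [B] on [S]: an element with image in
    [A *m B] differs from one of [A] by an element of [K]. The dimension formulas then give the
    exponent. *)
Lemma card_preim S A B : (A <= S)%MS ->
  #|[set v : 'rV[F]_n | (v <= S)%MS && (v *m B <= A *m B)%MS]| =
  (#|F| ^ (\rank (A *m B) + (\rank S - \rank (S *m B))))%N.
Proof.
move=> AS; set K := (S :&: kermx B)%MS.
have -> : (\rank (A *m B) + (\rank S - \rank (S *m B)) = \rank (A + K)%MS)%N.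
  have dAK : (\rank (A + K)%MS + \rank (A :&: K)%MS = \rank A + \rank K)%N.
    exact: mxrank_sum_cap.
  have dS : (\rank (S *m B) + \rank K = \rank S)%N by apply: mxrank_mul_ker.
  have dA : (\rank (A *m B) + \rank (A :&: kermx B)%MS = \rank A)%N.
    exact: mxrank_mul_ker.
  have -> : \rank (A *m B) = (\rank A - \rank (A :&: K)%MS)%N.
    by rewrite capmxA (cap_eqmx (capmx_idPl AS) (eqmx_refl _)) -dA addnK.
  have : (\rank (A :&: K)%MS <= \rank A)%N by apply/mxrankS/capmxSl.
  lia.
rewrite -card_submx; apply: eq_card => v; rewrite !inE; apply/andP/idP.
  case=> vS /submxP[D vB].
  rewrite -[v](subrK (D *m A)) addrC addmx_sub_adds ?submxMl //.
  rewrite sub_capmx addmx_sub ?eqmx_opp //=; last exact: submx_trans (submxMl _ _) AS.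
  by rewrite (sameP sub_kermxP eqP) mulmxBl vB mulmxA subrr.
case/sub_addsmxP => -[u1 u2] /= ->; split.
  apply: addmx_sub; apply: submx_trans (submxMl _ _) _ => //.
  exact: capmxSl.
have /sub_kermxP K0 : (K <= kermx B)%MS by apply: capmxSr.
by rewrite mulmxDl -!mulmxA K0 mulmx0 addr0 submxMl.
Qed.

(** If the first [i] parts of [l] add up to the dimension of the kernel of the i-th power, the
    remaining parts add up to its rank. *)
Definition tail_sum (l : nat -> nat) (i : nat) : nat := (\sum_(i <= k < n) l k)%N.

Lemma tail_recl l i : (i < n)%N -> tail_sum l i = (l i + tail_sum l i.+1)%N.
Proof. by move=> lt; rewrite /tail_sum big_ltn. Qed.

Lemma tail_n l : tail_sum l n = 0%N.
Proof. by rewrite /tail_sum big_geq. Qed.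

(* With [l] the row lengths of a shape (indexed from 0), this says that the shape
   of [N] on the span of the first [r] basis vectors is [l]: the parts of [JF] are
   the successive differences of the dimensions of the kernels of the [N^i]. *)
Definition has_ranks (r : nat) (l : nat -> nat) N : bool :=
  [forall i : 'I_n.+1, \rank (E r *m N ^+ i) == tail_sum l i].

Lemma has_ranksP r l N :
  reflect (forall i, (i <= n)%N -> \rank (E r *m N ^+ i) = tail_sum l i) (has_ranks r l N).
Proof.
apply: (iffP forallP) => [h i lt|h i]; last by rewrite h // -ltnS.
exact/eqP/(h (Ordinal (lt : (i < n.+1)%N))).
Qed.

Lemma eq_has_ranks r l l' N :
  (forall i, (i < n)%N -> l i = l' i) -> has_ranks r l N = has_ranks r l' N.
Proof.
move=> h; apply: eq_forallb => i; congr (_ == _); rewrite /tail_sum.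
by apply: eq_big_nat => k /andP[_ /h].
Qed.

(* The increments of the ranks of [E r N^i] are the dimensions of
   [E r N^i :&: ker N], hence grow with [r]. *)
Lemma has_ranks_mono r s l m N : (s <= r)%N ->
  has_ranks s m N -> has_ranks r l N -> forall i, (i < n)%N -> (m i <= l i)%N.
Proof.
move=> sr /has_ranksP hm /has_ranksP hl i lt.
have step t : \rank (E t *m N ^+ i) =
    (\rank (E t *m N ^+ i.+1) + \rank (E t *m N ^+ i :&: kermx N))%N.
  by rewrite exprSr -mulmxE mulmxA mxrank_mul_ker.
have le : (\rank (E s *m N ^+ i :&: kermx N) <= \rank (E r *m N ^+ i :&: kermx N))%N.
  by apply: mxrankS; apply: capmxS => //; apply: submxMr; apply: pid_sub.
have := step s; have := step r.
rewrite (hm _ lt) (hm _ (ltnW lt)) (hl _ lt) (hl _ (ltnW lt)).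
rewrite (tail_recl m) // (tail_recl l) //; lia.
Qed.

(** The shape before a box was put in row [i]. The subtraction is truncated, so this meaning needs
    the condition [0 < l i]. *)
Definition dec_at (i : nat) (l : nat -> nat) (k : nat) : nat := (l k - (k == i))%N.

Lemma tail_dec_at l i k : (i < n)%N -> (0 < l i)%N ->
  tail_sum l k = (tail_sum (dec_at i l) k + (k <= i))%N.
Proof.
move=> lt li; have [ki|ik] := leqP k i; rewrite /tail_sum.
  rewrite !(@big_cat_nat _ _ _ i k n) //= 1?ltnW // (big_ltn lt) [in RHS](big_ltn lt).
  rewrite /dec_at eqxx /=.
  rewrite (_ : (\sum_(k <= j < i) (l j - (j == i)) = \sum_(k <= j < i) l j)%N); last first.
    by apply: eq_big_nat => j ?; rewrite ltn_eqF ?subn0 //; lia.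
  rewrite (_ : (\sum_(i.+1 <= j < n) (l j - (j == i)) = \sum_(i.+1 <= j < n) l j)%N); last first.
    by apply: eq_big_nat => j ?; rewrite gtn_eqF ?subn0 //; lia.
  lia.
rewrite addn0; apply: eq_big_nat => j ?; rewrite /dec_at gtn_eqF ?subn0 //; lia.
Qed.

Section OneRow.
Variables (s : nat) (o : 'I_n) (mu : nat -> nat) (N0 : 'M[F]_n).
Hypotheses (so : (s <= o)%N) (hN0 : E o *m N0 = N0) (N0s : (N0 <= E s)%MS).
Hypothesis hmu : has_ranks s mu N0.
Hypothesis mu0 : mu n.-1 = 0%N.

Let n_gt0 : (0 < n)%N. Proof. by case: n o => [[]|]. Qed.

(** The new basis vector goes to [v] first and is then moved by [N0], so [v *m N0 ^+ i'] is its
    image under the power [i'+1]. The power 0 is the identity, for which the new vector always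
    counts. *)
Definition raises v i : bool :=
  if i is i'.+1 then ~~ (v *m N0 ^+ i' <= E o *m N0 ^+ i)%MS else true.

Definition at_level v i : bool := raises v i && ~~ raises v i.+1.

(** The old and the new matrix agree on [E o], which [N0] maps into [E s] and hence into itself;
    their powers agree there as well, and only the image of the new basis vector can add to the
    rank. *)
Lemma rank_addrow_expr v i : (v <= E s)%MS ->
  \rank (E o.+1 *m (N0 + delta_mx o 0 *m v) ^+ i) =
  (\rank (E o *m N0 ^+ i) + raises v i)%N.
Proof.
move=> vs; set N1 := _ + _.
have E1 j : E o *m N1 ^+ j = E o *m N0 ^+ j.
  apply/esym/mulmx_expr_eq; rewrite ?pid_addrow // hN0.
  exact: submx_trans N0s (pid_sub _ _ _).
have split_rank (A : 'M[F]_n) :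
    (E o.+1 *m A :=: E o *m A + (delta_mx 0 o : 'rV_n) *m A)%MS.
  rewrite pid_mxS mulmxDl -mulmxA; apply: eqmx_addrow.
  by rewrite mulmxA pid_pid.
rewrite split_rank; case: i => [|i]; rewrite rank_adds_row /=.
  rewrite !expr0 !mulmx1; congr (_ + _)%N; apply/eqP; rewrite eqb1.
  apply/negP => /submxP[D /(congr1 (mulmx^~ (delta_mx o 0 : 'cV_n)))].
  rewrite mul_delta_mx -mulmxA pid_mul_delta // mulmx0 => /matrixP/(_ 0 0).
  by rewrite !mxE !eqxx => /eqP; rewrite oner_eq0.
rewrite E1; congr (_ + ~~ _)%N; congr (_ <= _)%MS.
rewrite exprS -mulmxE mulmxA -rowE row_addrow //.
have /submxP[D ->] : (v <= E o)%MS by apply: submx_trans vs (pid_sub _ _ _).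
by rewrite -!mulmxA E1.
Qed.

(** Multiplying by [N0] preserves the membership that [raises] negates, so the raised indices form
    an initial segment and its last element is the level. *)
Lemma raisesS v i : raises v i.+1 -> raises v i.
Proof.
case: i => //= i; apply: contra => h.
by rewrite [in X in (X <= _)%MS]exprSr exprSr -mulmxE !mulmxA submxMr.
Qed.

Lemma raises_anti v i j : (i <= j)%N -> raises v j -> raises v i.
Proof.
move=> /subnKC <-; elim: (j - i)%N => [|d IH]; rewrite ?addn0 // addnS.
by move/raisesS.
Qed.

(** As [mu] vanishes at [n-1], the power [N0 ^+ n.-1] kills [E s]. This bounds the level below
    [n]. *)
Lemma raises_n v : (v <= E s)%MS -> raises v n = false.
Proof.
move=> vs; rewrite -(prednK n_gt0) /=; apply/negbTE; rewrite negbK.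
have : E s *m N0 ^+ n.-1 = 0.
  apply/eqP; rewrite -mxrank_eq0 (has_ranksP _ _ _ hmu) ?leq_pred //.
  by rewrite tail_recl ?prednK // mu0 tail_n.
by case/submxP: vs => D -> h; rewrite -mulmxA h mulmx0 sub0mx.
Qed.

Lemma at_level_raises v i j : at_level v i -> raises v j = (j <= i)%N.
Proof.
case/andP=> ri nri; apply/idP/idP => [rj|ji]; last exact: raises_anti ji ri.
by rewrite leqNgt; apply: contra nri => ij; apply: raises_anti ij rj.
Qed.

Lemma exists_level v : (v <= E s)%MS -> exists i : 'I_n, at_level v i.
Proof.
move=> vs; have ex : exists j, ~~ raises v j by exists n; rewrite raises_n.
case: (ex_minnP ex) => -[|j] // nr mn.
have jn : (j < n)%N by apply: mn; rewrite raises_n.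
exists (Ordinal jn); rewrite /at_level /= -/(raises v j.+1) nr andbT.
by apply/negPn/negP => /mn; rewrite ltnn.
Qed.

Lemma has_ranks_addrow v i l : (i < n)%N -> (v <= E s)%MS -> at_level v i ->
  has_ranks o.+1 l (N0 + delta_mx o 0 *m v) =
  (0 < l i)%N && has_ranks o (dec_at i l) N0.
Proof.
move=> lt vs lev; have rE j := at_level_raises j lev.
apply/idP/andP => [/has_ranksP h|[li /has_ranksP h]].
  have h' j : (j <= n)%N -> (\rank (E o *m N0 ^+ j) + (j <= i) = tail_sum l j)%N.
    by move=> jn; rewrite -h // rank_addrow_expr // rE.
  (* The extra 1 is present at [i] and absent at [i+1], while the old ranks do not increase with the
     exponent. *)
  have li : (0 < l i)%N.
    have := h' i (ltnW lt); have := h' _ lt; rewrite leqnn ltnn (tail_recl l lt).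
    have : (\rank (E o *m N0 ^+ i.+1) <= \rank (E o *m N0 ^+ i))%N.
      by rewrite exprSr -mulmxE mulmxA mxrankM_maxl.
    lia.
  split=> //; apply/has_ranksP => j jn.
  by have := h' j jn; rewrite (tail_dec_at j lt li) => /addIn.
apply/has_ranksP => j jn; rewrite rank_addrow_expr // rE h //.
by rewrite (tail_dec_at j lt li).
Qed.

(** This is [card_preim] with [S = E s], [A = N0] and [B = N0 ^+ i], since [E o *m N0 = N0]. *)
Lemma card_not_raises l i : (i < n)%N -> has_ranks o l N0 ->
  #|[set v : 'rV[F]_n | (v <= E s)%MS && ~~ raises v i.+1]| =
  (#|F| ^ (tail_sum l i.+1 + (s - tail_sum mu i)))%N.
Proof.
move=> lt /has_ranksP hl.
rewrite -(hl _ lt) -(has_ranksP _ _ _ hmu _ (ltnW lt)).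
have sn : (s <= n)%N by apply: leq_trans so (ltnW (ltn_ord o)).
rewrite -[X in (_ + (X - _))%N](rank_pid F sn) exprS -mulmxE mulmxA hN0.
rewrite -card_preim //; apply: eq_card => v; rewrite !inE negbK.
by rewrite exprS -mulmxE mulmxA hN0.
Qed.

(** Vectors that do not raise [i+1], less those that do not raise [i]; there are none of the latter
    when [i] is 0. Here [l] is the shape before the new box. *)
Definition level_card (l : nat -> nat) (i : nat) : nat :=
  (#|F| ^ (tail_sum l i.+1 + (s - tail_sum mu i)) -
   (if i is i'.+1 then #|F| ^ (tail_sum l i + (s - tail_sum mu i')) else 0))%N.

Lemma card_at_level l i : (i < n)%N -> has_ranks o l N0 ->
  #|[set v : 'rV[F]_n | (v <= E s)%MS && at_level v i]| = level_card l i.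
Proof.
move=> lt hl; rewrite /level_card -card_not_raises //.
case: i lt => [|i] lt.
  by rewrite subn0; apply: eq_card => v; rewrite !inE.
rewrite -card_not_raises // 1?ltnW //.
set X := [set v | _ && ~~ raises v i.+2]; set Y := [set v | _ && ~~ raises v i.+1].
have -> : Y = X :&: Y.
  apply/setP => v; rewrite !inE; case: (v <= _)%MS => //=.
  by rewrite andb_idl //; apply/contra/raisesS.
rewrite -(cardsID Y X) addnC addnK; apply: eq_card => v; rewrite !inE.
by rewrite /at_level; case: (v <= _)%MS; rewrite //= !negbK andbC.
Qed.

Lemma card_row_ext l :
  #|[set v : 'rV[F]_n | (v <= E s)%MS && has_ranks o.+1 l (N0 + delta_mx o 0 *m v)]| =
  (\sum_(i < n | (0 < l i) && has_ranks o (dec_at i l) N0)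
     level_card (dec_at i l) i)%N.
Proof.
rewrite -sum1_card.
rewrite (eq_bigl (fun v : 'rV_n => (v <= E s)%MS && has_ranks o.+1 l (N0 + delta_mx o 0 *m v)%R));
  last by move=> v; rewrite inE.
(* Each vector has exactly one level, so the count can be sorted by levels. *)
rewrite (eq_bigr (fun v : 'rV_n => \sum_(i < n | at_level v i) 1)%N); last first.
  move=> v /andP[vs _]; have [i lev] := exists_level vs.
  rewrite (big_pred1 i) // => j; apply/idP/eqP => [levj|->//]; apply/val_inj/eqP.
  have := at_level_raises i levj; have := at_level_raises j lev.
  rewrite (at_level_raises i lev) (at_level_raises j levj) !leqnn.
  by rewrite eqn_leq => <- <-.
rewrite (exchange_big_dep xpredT) //= [RHS]big_mkcond /=; apply: eq_bigr => i _.
case: ifP => [/andP[li hl]|hneg].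
  rewrite -(card_at_level (ltn_ord i) hl) -sum1_card; apply: eq_bigl => v.
  rewrite inE -andbA; case vs: (v <= _)%MS => //=.
  by rewrite andb_idl // => lev; rewrite (has_ranks_addrow _ _ vs lev) // li.
rewrite big1 // => v /andP[/andP[vs hr] lev].
by rewrite (has_ranks_addrow _ _ vs lev) // hneg in hr.
Qed.

End OneRow.
End Extensions.

(** * Filling one block of rows *)

Section BlockCount.
Variables (F : finFieldType) (n : nat).
Implicit Types (N : 'M[F]_n) (v : 'rV[F]_n).
Local Notation E := (@pid_mx F n n).
Local Notation tail_sum := (tail_sum n).

(** The rows of index [s] to [r-1] belong to one step of the flag, and strict compatibility puts all
    of them in [E s]. The set [Y] holds the admissible choices of the first [s] rows. *)
Definition shape_ext (Y : {set 'M[F]_n}) (s r : nat) (l : nat -> nat) : {set 'M[F]_n} :=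
  [set N | (E r *m N == N) &&
     [&& E s *m N \in Y, (N <= E s)%MS & has_ranks r l N]].

Local Notation Q := (#|F|%:R : rat).

(** The counting is done with this form of the q-factorial, polynomial in [Q]; [qprod_qfact] makes
    the change to [q]. *)
Definition qprod (m : nat) : rat := \prod_(1 <= i < m.+1) (Q ^+ i - 1).

Lemma card_field_gt1 : (1 < #|F|)%N.
Proof. exact: card_finNzRing_gt1. Qed.

Lemma qprodS m : qprod m.+1 = qprod m * (Q ^+ m.+1 - 1).
Proof. by rewrite /qprod big_nat_recr. Qed.

Lemma qpow_sub1_neq0 m : (0 < m)%N -> Q ^+ m - 1 != 0.
Proof.
move=> m0; rewrite subr_eq0 gt_eqF // exprn_egt1 ?ltr1n ?card_field_gt1 //.
by rewrite -lt0n.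
Qed.

Lemma qprod_neq0 m : qprod m != 0.
Proof.
elim: m => [|m IH]; first by rewrite /qprod big_geq // oner_eq0.
by rewrite qprodS mulf_neq0 // qpow_sub1_neq0.
Qed.

Section Block.
Variables (s : nat) (mu : nat -> nat) (Y : {set 'M[F]_n}).
Hypothesis sn : (s <= n)%N.
Hypothesis mu_dec : forall i, (mu i.+1 <= mu i)%N.
Hypothesis mu_sum : tail_sum mu 0 = s.
Hypothesis hY : forall N, N \in Y ->
  [/\ E s *m N = N, (N <= E s)%MS & has_ranks s mu N].

Lemma tail_le i : (i <= n)%N -> (tail_sum mu i <= s)%N.
Proof.
by move=> lt; rewrite -mu_sum /tail_sum (@big_cat_nat _ _ _ i 0 n) //= leq_addl.
Qed.

Lemma mu_anti i j : (i <= j)%N -> (mu j <= mu i)%N.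
Proof.
move/subnKC <-; elim: (j - i)%N => [|d IH]; rewrite ?addn0 // addnS.
exact: leq_trans (mu_dec _) IH.
Qed.

(** A partition of a number below [n] cannot have [n] positive parts. *)
Lemma mu_last : (s < n)%N -> mu n.-1 = 0%N.
Proof.
move=> lt; apply/eqP; rewrite -leqn0 leqNgt; apply/negP => pos.
have : (\sum_(0 <= k < n) 1 <= tail_sum mu 0)%N.
  rewrite /tail_sum !big_mkord; apply: leq_sum => i _.
  by apply: leq_trans pos (mu_anti _); have := ltn_ord i; lia.
by rewrite sum_nat_const_nat subn0 muln1 mu_sum leqNgt lt.
Qed.

Lemma core_ranks N : E s *m N \in Y -> (N <= E s)%MS -> has_ranks s mu N.
Proof.
move=> NY Ns; have [_ _ /has_ranksP h] := hY NY; apply/has_ranksP => i lt.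
rewrite -h //; congr (\rank _); apply: mulmx_expr_eq; last by rewrite mulmxA pid_pid.
exact: submx_trans (submxMl _ _) Ns.
Qed.

Lemma card_shape_extS (o : 'I_n) l : (s <= o)%N ->
  #|shape_ext Y s o.+1 l| =
  (\sum_(i < n | 0 < l i)
     #|shape_ext Y s o (dec_at i l)| * level_card F n s mu (dec_at i l) i)%N.
Proof.
move=> so; rewrite (@card_addrow _ _ o
  (fun N => [&& E s *m N \in Y, (N <= E s)%MS & has_ranks o.+1 l N])) /=.
rewrite (eq_bigr (fun N0 => \sum_(i < n | (0 < l i) && (N0 \in shape_ext Y s o (dec_at i l)))
    level_card F n s mu (dec_at i l) i)%N).
  rewrite (exchange_big_dep (fun i : 'I_n => (0 < l i)%N)) /=; last by move=> N i _ /andP[].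
  apply: eq_bigr => i li; rewrite -sum_nat_const; apply: eq_bigl => N.
  by rewrite li /= andb_idl // inE => /andP[].
move=> N0 /eqP hN0.
have [/andP[NY Ns]|hneg] := boolP ((E s *m N0 \in Y) && (N0 <= E s)%MS).
  have hmu := core_ranks NY Ns.
  have sn' : (s < n)%N by apply: leq_ltn_trans so (ltn_ord o).
  rewrite (eq_bigl (fun i : 'I_n => (0 < l i)%N && has_ranks o (dec_at i l) N0)).
    rewrite -(card_row_ext so hN0 Ns hmu (mu_last sn')).
    apply: eq_card => v; rewrite !inE pid_addrow // NY addrow_sub // Ns //.
  by move=> i; rewrite inE hN0 eqxx NY Ns.
rewrite big_pred0 => [|i]; last first.
  by rewrite inE andbC hN0 eqxx /= andbA (negbTE hneg).
apply/eqP; rewrite cards_eq0; apply/eqP/setP => v; rewrite !inE pid_addrow //.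
by rewrite addrow_sub // -!andbA andbA; apply: contraNF hneg => /andP[/andP[-> ->]].
Qed.

(* The contribution of [x] new boxes in row [i] (indexed from 0) above the shape
   [mu] of size [s]; row 0, where any number of boxes fits, has no product. *)
Definition row_weight (i x : nat) : rat :=
  (if i is i'.+1 then \prod_(t < x) (Q ^+ (mu i' - mu i) - Q ^+ t) else 1)
  * Q ^+ (x * (s - mu i.-1)) / qprod x.

(** Compares the weights before and after the last box of row [i]. The difference of powers on the
    right is chosen so that the sum over [i] telescopes. *)
Lemma level_card_weight (a : nat -> nat) i : (i < n)%N -> (0 < a i)%N ->
  (level_card F n s mu (dec_at i (fun k => mu k + a k)%N) i)%:R * row_weight i (a i).-1 =
  row_weight i (a i) * (Q ^+ tail_sum a i - Q ^+ tail_sum a i.+1).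
Proof.
move=> lt ai; set l := fun k => _.
have li : (0 < l i)%N by rewrite /l; lia.
have tl k : tail_sum l k = (tail_sum mu k + tail_sum a k)%N by rewrite /tail_sum big_split.
have t1 : tail_sum (dec_at i l) i.+1 = (tail_sum mu i.+1 + tail_sum a i.+1)%N.
  by rewrite -tl (tail_dec_at i.+1 lt li) ltnn addn0.
have t0 : tail_sum (dec_at i l) i = (tail_sum mu i + (tail_sum a i.+1 + (a i).-1))%N.
  have := tail_dec_at i lt li; rewrite leqnn tl (tail_recl a) //; lia.
have mi := tail_recl mu lt; have ms := tail_le (ltnW lt).
rewrite /level_card t1 (_ : _ + _ = tail_sum a i.+1 + (s - mu i))%N; last by lia.
rewrite (tail_recl a lt); case: (a i) ai t0 => // x _ /= t0.
rewrite /row_weight qprodS.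
have px := qprod_neq0 x; have q1 := @qpow_sub1_neq0 x.+1 isT.
case: i lt li t0 t1 mi ms {tl} => [|i] lt li t0 t1 mi ms /=.
  rewrite subn0 natrX mulSn !exprD; move: (Q ^+ x.+1) q1 => z q1; field.
  by rewrite q1 px.
have mi' := tail_recl mu (ltnW lt); have ms' := tail_le (ltnW (ltnW lt)).
have md := mu_dec i.
rewrite t0 (_ : _ + _ + (s - tail_sum mu i) = tail_sum a i.+2 + x + (s - mu i))%N; last by lia.
rewrite (_ : s - mu i.+1 = (mu i - mu i.+1) + (s - mu i))%N; last by lia.
set y := (mu i - mu i.+1)%N; rewrite big_ord_recr /=.
(* For [x > y] both products contain the zero factor with [t = y]. For [x <= y] the exponents in
   [level_card] are in the right order, so its truncated subtraction is exact. *)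
have [xy|yx] := leqP x y; last first.
  have -> : \prod_(t < x) (Q ^+ y - Q ^+ t) = 0.
    by rewrite (bigD1 (Ordinal yx)) //= subrr mul0r.
  by rewrite !mul0r mulr0.
rewrite natrB ?leq_pexp2l ?(ltnW card_field_gt1) //; last by lia.
rewrite !natrX mulSn !exprD; move: (Q ^+ x.+1) q1 => z q1; field.
by rewrite q1 px.
Qed.

(** Induction on the number of boxes, sorting by the row of the last one. The weights factor out,
    and the remaining sum [tel] is the factor by which [qprod] grows. *)
Lemma card_shape_ext (d : nat) (a : nat -> nat) : (s + d <= n)%N -> tail_sum a 0 = d ->
  #|shape_ext Y s (s + d) (fun k => mu k + a k)%N|%:R =
  #|Y|%:R * qprod d * \prod_(i < n) row_weight i (a i) :> rat.
Proof.
elim: d a => [|d IH] a sd ad.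
  have a0 i : (i < n)%N -> a i = 0%N.
    move=> lt; apply/eqP; move/eqP: ad; rewrite /tail_sum big_mkord sum_nat_eq0.
    by move/forallP/(_ (Ordinal lt)).
  rewrite addn0 /qprod big_geq // mulr1 big1 => [|i _]; last first.
    rewrite a0 // /row_weight mul0n expr0 mulr1 /qprod [in X in _ / X]big_geq // divr1.
    by case: (nat_of_ord i) => // k; rewrite big_ord0.
  rewrite mulr1; congr _%:R; apply: eq_card => N; rewrite inE.
  rewrite (@eq_has_ranks _ _ _ _ mu) => [|i lt]; last by rewrite a0 // addn0.
  apply/idP/idP => [/and4P[/eqP ->]//|NY].
  by have [-> -> ->] := hY NY; rewrite eqxx NY.
rewrite addnS in sd *; set o := Ordinal sd.
rewrite (@card_shape_extS o) /= ?leq_addr // natr_sum.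
have tel : \prod_(i < n) row_weight i (a i) * (Q ^+ d.+1 - 1) =
  \sum_(i < n) \prod_(j < n) row_weight j (a j) * (Q ^+ tail_sum a i - Q ^+ tail_sum a i.+1).
  rewrite -mulr_sumr -(big_mkord xpredT (fun i => Q ^+ tail_sum a i - Q ^+ tail_sum a i.+1)).
  under eq_bigr do rewrite -opprB.
  by rewrite sumrN telescope_sumr // opprB ad tail_n expr0.
rewrite qprodS -mulrA -[_ * _ * \prod_(i < n) _]mulrA [_ * \prod_(i < n) _]mulrC tel.
rewrite !mulr_sumr big_mkcond /=; apply: eq_bigr => i _.
(* If row [i] has no new box, removing one would cut into [mu], which [has_ranks_mono] excludes; the
   summand is zero on both sides. *)
have [ai0|ai] := posnP (a i).
  rewrite (tail_recl a (ltn_ord i)) ai0 add0n subrr !mulr0.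
  case: ifP => // mi; rewrite natrM [X in X%:R * _](_ : _ = 0%N) ?mul0r //.
  apply/eqP; rewrite cards_eq0; apply/eqP/setP => N; rewrite inE in_set0.
  apply/negP => /and4P[_ NY Ns hl]; have := ltn_ord i.
  have hmu' : has_ranks s mu N by exact: core_ranks Ns.
  move/(has_ranks_mono (leq_addr d s) hmu' hl).
  rewrite /dec_at eqxx ai0; lia.
rewrite addn_gt0 ai orbT natrM.
have ti := tail_dec_at 0 (ltn_ord i) ai.
have eX : shape_ext Y s o (dec_at i (fun k => mu k + a k)%N) =
          shape_ext Y s (s + d) (fun k => mu k + dec_at i a k)%N.
  apply/setP => N; rewrite !inE; do 3!congr (_ && _); apply: eq_has_ranks => k _.
  by rewrite /dec_at; case: eqP => [->|_]; lia.
rewrite eX IH; [|exact: ltnW|by move: ti; rewrite ad leq0n; lia].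
rewrite (bigD1 i) //= [in RHS](bigD1 i) //=.
have -> : \prod_(j < n | j != i) row_weight j (dec_at i a j) =
          \prod_(j < n | j != i) row_weight j (a j).
  by apply: eq_bigr => j ji; rewrite /dec_at (negbTE (ji : (j : nat) != i)) subn0.
have := level_card_weight (ltn_ord i) ai.
rewrite [dec_at i a i]/dec_at eqxx subn1.
move: (level_card _ _ _ _ _ _)%:R (\prod_(j < n | _) _) (_ - _) => lc R D key.
rewrite [_ * D]mulrAC -key; ring.
Qed.

End Block.
End BlockCount.

(** * Iteration over the steps of a flag *)

Section Towers.
Variables (F : finFieldType) (n : nat).
Implicit Types (N g W : 'M[F]_n).
Local Notation E := (@pid_mx F n n).
Local Notation tail_sum := (tail_sum n).
Variables (k : nat) (s : nat -> nat).
Hypotheses (s0 : s 0 = 0%N) (s_mono : forall i j, (i <= j)%N -> (s i <= s j)%N).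
Hypothesis sk : s k = n.

Let s_le i : (i <= k)%N -> (s i <= n)%N. Proof. by move/s_mono; rewrite sk. Qed.

Fixpoint frames (V : nat -> 'M[F]_n) (j : nat) : {set 'M[F]_n} :=
  if j is j'.+1 then frame_ext (frames V j') (s j') (s j) (V j) else [set 0].

Section Frames.
Variable V : nat -> 'M[F]_n.
Hypothesis V_mono : forall i, (i < k)%N -> (V i <= V i.+1)%MS.
Hypothesis V_rank : forall i, (i <= k)%N -> \rank (V i) = s i.

Lemma frames_spec j g : (j <= k)%N -> g \in frames V j ->
  [/\ E (s j) *m g = g, (g <= V j)%MS & \rank g = s j].
Proof.
case: j => [|j] jk /=.
  by move/set1P->; rewrite mulmx0 sub0mx mxrank0 s0.
by rewrite inE => /and4P[/eqP -> _ -> /eqP ->].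
Qed.

Lemma card_frames j : (j <= k)%N ->
  #|frames V j| = (\prod_(i < j) \prod_(s i <= t < s i.+1) (#|F| ^ s i.+1 - #|F| ^ t))%N.
Proof.
elim: j => [|j IH] jk; first by rewrite big_ord0 cards1.
rewrite big_ord_recr /= -IH ?(ltnW jk) // card_frame_ext ?V_rank //.
  by rewrite s_mono //= s_le.
move=> g /(frames_spec (ltnW jk))[-> h ->]; split=> //.
exact: submx_trans h (V_mono jk).
Qed.

(** Unfolds the recursion: a full-rank matrix is an adapted frame once each initial group of rows
    lies in the matching subspace. *)
Lemma mem_frames j g : (j <= k)%N ->
  reflect [/\ E (s j) *m g = g, \rank g = s j &
              forall i, (i <= j)%N -> (E (s i) *m g <= V i)%MS]
          (g \in frames V j).
Proof.
elim: j g => [|j IH] g jk /=.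
  rewrite s0 pid_mx_0 mul0mx; apply: (iffP set1P) => [->|[<-]//].
  by rewrite mxrank0; split=> // i; rewrite leqn0 => /eqP ->; rewrite s0 pid_mx_0 mul0mx sub0mx.
have sj := s_mono (leqnSn j).
rewrite inE; apply: (iffP and4P) => [[/eqP eg /(IH _ (ltnW jk))[_ _ h] gV /eqP rg]|[eg rg h]].
  split=> // i; rewrite leq_eqVlt => /orP[/eqP -> //|ij]; first by rewrite eg.
  by have := h i ij; rewrite mulmxA pid_pid // s_mono.
split; rewrite ?eg ?rg //; last by rewrite -eg h.
apply/(IH _ (ltnW jk)); split=> [||i ij]; first by rewrite mulmxA pid_pid.
  (* Full rank means that [E (s j.+1)] meets the kernel of [g] trivially. The smaller [E (s j)] then
     does too, so truncation keeps full rank. *)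
  have d r : (\rank (E r *m g) + \rank (E r :&: kermx g) = \rank (E r))%N.
    exact: mxrank_mul_ker.
  have := d (s j.+1); have := d (s j); rewrite eg rg !rank_pid ?s_le ?(ltnW jk) //.
  have : (\rank (E (s j) :&: kermx g) <= \rank (E (s j.+1) :&: kermx g))%N.
    by apply/mxrankS/capmxS => //; apply: pid_sub.
  lia.
by rewrite mulmxA pid_pid ?s_mono // h // ltnW.
Qed.

End Frames.

Section Shapes.
Variable tau : nat -> nat -> nat.
Hypothesis tau0 : forall i, tau 0 i = 0%N.
Hypothesis tau_dec : forall j i, (j <= k)%N -> (tau j i.+1 <= tau j i)%N.
Hypothesis tau_mono : forall j i, (j < k)%N -> (tau j i <= tau j.+1 i)%N.
Hypothesis tau_sum : forall j, (j <= k)%N -> tail_sum (tau j) 0 = s j.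

Fixpoint shapes (j : nat) : {set 'M[F]_n} :=
  if j is j'.+1 then shape_ext (shapes j') (s j') (s j) (tau j) else [set 0].

Lemma shapes_spec j N : (j <= k)%N -> N \in shapes j ->
  [/\ E (s j) *m N = N, (N <= E (s j))%MS & has_ranks (s j) (tau j) N].
Proof.
case: j => [|j] jk /=.
  move/set1P->; rewrite mulmx0 sub0mx; split=> //; apply/has_ranksP => i _.
  rewrite s0 pid_mx_0 mul0mx mxrank0 /tail_sum; apply/esym/eqP.
  by rewrite sum_nat_seq_eq0; apply/allP => t _; rewrite tau0.
rewrite inE => /and4P[/eqP -> _ h ->]; split=> //.
exact: submx_trans h (pid_sub _ _ (s_mono (leqnSn _))).
Qed.

Lemma card_shapes j : (j <= k)%N ->
  #|shapes j|%:R = \prod_(i < j) (qprod F (s i.+1 - s i) *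
    \prod_(t < n) row_weight F (s i) (tau i) t (tau i.+1 t - tau i t)) :> rat.
Proof.
elim: j => [|j IH] jk; first by rewrite big_ord0 cards1.
rewrite big_ord_recr /= -IH ?(ltnW jk) // mulrA.
have sj := s_mono (leqnSn j).
have -> : #|shape_ext (shapes j) (s j) (s j.+1) (tau j.+1)| =
   #|shape_ext (shapes j) (s j) (s j + (s j.+1 - s j))
      (fun t => tau j t + (tau j.+1 t - tau j t))%N|.
  rewrite subnKC //; apply: eq_card => N; rewrite !inE; do 3!congr (_ && _).
  by apply: eq_has_ranks => t _; rewrite subnKC // tau_mono.
apply: card_shape_ext.
- by apply: s_le; apply: ltnW.
- by move=> i; apply/tau_dec/ltnW.
- by apply/tau_sum/ltnW.
- by move=> N; apply/shapes_spec/ltnW.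
- by rewrite subnKC // s_le.
rewrite -(tau_sum jk) -(tau_sum (ltnW jk)) /tail_sum -sumnB // => i _.
exact: tau_mono.
Qed.

(** Identifies the recursively built set with the matrices strictly compatible with the standard
    flag and of prescribed shapes. Each step is stable under [N], so ranks there can be read off a
    truncation. *)
Lemma mem_shapes j N : (j <= k)%N ->
  reflect [/\ E (s j) *m N = N,
              forall i, (i < j)%N -> (E (s i.+1) *m N <= E (s i))%MS &
              forall i, (i <= j)%N -> has_ranks (s i) (tau i) N]
          (N \in shapes j).
Proof.
elim: j N => [|j IH] N jk.
  apply: (iffP idP) => [h|[h _ _]]; last by rewrite inE -h s0 pid_mx_0 mul0mx.
  by have [-> _ ?] := shapes_spec jk h; split=> // i; rewrite leqn0 => /eqP ->.
have sj := s_mono (leqnSn j).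
have ranksE i : (i <= j)%N -> (E (s i) *m N <= E (s i))%MS ->
    has_ranks (s i) (tau i) N = has_ranks (s i) (tau i) (E (s j) *m N).
  move=> ij h; apply: eq_forallb => t; congr (\rank _ == _).
  by apply: mulmx_expr_eq => //; rewrite mulmxA pid_pid // s_mono.
have stab i : (forall t, (t < j)%N -> (E (s t.+1) *m N <= E (s t))%MS) ->
    (i <= j)%N -> (E (s i) *m N <= E (s i))%MS.
  case: i => [|i] h ij; first by rewrite s0 pid_mx_0 mul0mx sub0mx.
  exact: submx_trans (h i ij) (pid_sub _ _ (s_mono (leqnSn _))).
rewrite /= inE; apply: (iffP and4P) => [[/eqP eN /(IH _ (ltnW jk))[_ hs hr] Ns rN]|[eN hs hr]].
  have hs' i : (i < j)%N -> (E (s i.+1) *m N <= E (s i))%MS.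
    by move=> ij; have := hs i ij; rewrite mulmxA pid_pid ?s_mono.
  split=> // i; rewrite ?ltnS leq_eqVlt => /orP[/eqP ->|ij] //; first by rewrite eN.
  - exact: hs'.
  by rewrite ranksE ?hr //; apply: stab.
have hs' t : (t < j)%N -> (E (s t.+1) *m N <= E (s t))%MS by move/ltnW/hs.
split; rewrite ?eN ?hr //; last by rewrite -eN hs.
apply/(IH _ (ltnW jk)); split=> [|i ij|i ij]; first by rewrite mulmxA pid_pid.
  by rewrite mulmxA pid_pid ?hs' // s_mono.
by rewrite -ranksE ?hr ?leqW //; apply: stab.
Qed.

End Shapes.
End Towers.

(** By rank-nullity [jfpart] is a difference of consecutive ranks; the hypothesis fixes the rank for
    exponent 0, and the differences then determine the others. *)
Lemma forall_jfpart (F : finFieldType) (n : nat) (W N : 'M[F]_n) (l : nat -> nat) :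
  tail_sum n l 0 = \rank W ->
  [forall m : 'I_n, jfpart W N m.+1 == l m] =
  [forall m : 'I_n.+1, \rank (W *m N ^+ m) == tail_sum n l m].
Proof.
move=> l0; pose R m := \rank (W *m N ^+ m).
have RS m : (R m.+1 <= R m)%N.
  by rewrite /R exprSr -mulmxE mulmxA mxrankM_maxl.
have dk m : (R m + dimker_restr W N m = \rank W)%N by apply: mxrank_mul_ker.
have jf m : jfpart W N m.+1 = (R m - R m.+1)%N.
  by rewrite /jfpart /=; have := dk m; have := dk m.+1; have := RS m; lia.
apply/forallP/forallP => h m.
  apply/eqP; have := ltn_ord m; rewrite ltnS.
  elim: (m : nat) => [|i IH] lt; first by rewrite expr0 mulmx1 l0.
  have /eqP := h (Ordinal lt); rewrite jf /= -/(R i.+1).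
  have := IH (ltnW lt); rewrite -/(R i) (tail_recl l lt); have := RS i; lia.
rewrite jf; have /eqP := h (lift ord0 m); have /eqP := h (widen_ord (leqnSn n) m).
rewrite -!/(R _) /= (tail_recl l (ltn_ord m)) /bump /= add1n; lia.
Qed.

(** * Transport from arbitrary flags to the standard flag *)

Section DoubleCount.
Variables (F : finFieldType) (n : nat) (alpha : seq nat) (T : seq (seq nat)).
Implicit Types (N g M : 'M[F]_n).
Local Notation E := (@pid_mx F n n).
Local Notation k := (size alpha).

Definition psum (j : nat) : nat := sumn (take j alpha).
Definition rows (j i : nat) : nat := tshape T j i.+1.

Lemma psum0 : psum 0 = 0%N. Proof. by rewrite /psum take0. Qed.

Lemma psum_mono i j : (i <= j)%N -> (psum i <= psum j)%N.
Proof.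
move=> ij; rewrite /psum -(cat_take_drop i (take j alpha)) take_takel // sumn_cat.
exact: leq_addr.
Qed.

Hypothesis alpha_n : sumn alpha = n.
Hypothesis rows0 : forall i, rows 0 i = 0%N.
Hypothesis rows_sum : forall j, (j <= k)%N -> tail_sum n (rows j) 0 = psum j.

Lemma psum_size : psum k = n. Proof. by rewrite /psum take_size. Qed.

Let psum_le j : (j <= k)%N -> (psum j <= n)%N.
Proof. by move/psum_mono; rewrite psum_size. Qed.

(** The translate of the standard flag by [g]; [genmx] picks the canonical matrices that [is_flag]
    demands. *)
Definition flag_of g : {ffun 'I_k.+1 -> 'M[F]_n} :=
  [ffun i : 'I_k.+1 => genmx (E (psum i) *m g)].

Definition pairs : {set {ffun 'I_k.+1 -> 'M[F]_n} * 'M[F]_n} :=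
  [set p | [&& is_flag p.1, strictly_compatible p.1 p.2 & JF_eq p.1 p.2 T]].

Lemma flag_rank (V : {ffun 'I_k.+1 -> 'M[F]_n}) i :
  is_flag V -> (i <= k)%N -> \rank (V (inord i)) = psum i.
Proof.
case/andP=> /forallP h _ ik; have /andP[_ /eqP ->] := h (inord i).
by rewrite inordK.
Qed.

Lemma flag_ofP (V : {ffun 'I_k.+1 -> 'M[F]_n}) g : is_flag V ->
  ((g \in unitmx) && (flag_of g == V)) =
  (g \in frames psum (fun i => V (inord i)) k).
Proof.
move=> fV; have /andP[/forallP h /forallP hm] := fV.
apply/andP/(mem_frames psum0 psum_mono psum_size _ _ (leqnn k)).
  case=> gu /eqP <-; rewrite psum_size pid_mx_1 mul1mx; split=> //.
    by rewrite mxrank_unit.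
  by move=> i ik; rewrite ffunE genmxE inordK.
rewrite psum_size => -[_ rg gV].
have gu : g \in unitmx by rewrite -row_full_unit /row_full rg.
split=> //; apply/eqP/ffunP => i; rewrite ffunE.
have /andP[/eqP eV /eqP rV] := h i.
rewrite [RHS]eV; apply/genmxP; rewrite -mxrank_leqif_eq.
  by rewrite rV mxrankMfree ?row_free_unit // rank_pid // psum_le // -ltnS.
by have := gV i; rewrite -ltnS ltn_ord inord_val; apply.
Qed.

Lemma flag_of_flag g : g \in unitmx -> is_flag (flag_of g).
Proof.
move=> gu; apply/andP; split; apply/forallP => i; rewrite !ffunE.
  rewrite genmx_id eqxx mxrank_gen mxrankMfree ?row_free_unit //.
  by apply/eqP/rank_pid/psum_le; rewrite -ltnS.
have lt := ltn_ord i; rewrite !genmxE !inordK ?ltnS ?(ltnW lt) //.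
by apply/submxMr/pid_sub/psum_mono.
Qed.

(** The conjugate [N] satisfies [g *m N ^+ m = M ^+ m *m g], and right multiplication by the
    invertible [g] changes neither ranks nor inclusions. *)
Lemma flag_of_pairs g M : g \in unitmx ->
  ((flag_of g, invmx g *m M *m g) \in pairs) = (M \in shapes F n psum rows k).
Proof.
move=> gu; rewrite inE flag_of_flag //=; set N := _ *m g.
have gN : g *m N = M *m g by rewrite !mulmxA mulmxV // mul1mx.
have gNX m : g *m N ^+ m = M ^+ m *m g.
  elim: m => [|m IH]; first by rewrite !expr0 mulmx1 mul1mx.
  by rewrite !exprS -!mulmxE mulmxA gN -!mulmxA IH.
have free : row_free g by rewrite row_free_unit.
have comp i : (i < k)%N ->
    ((flag_of g (inord i.+1) *m N)%R <= flag_of g (inord i))%MS =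
    (E (psum i.+1) *m M <= E (psum i))%MS.
  move=> ik; rewrite !ffunE !inordK ?ltnS ?(ltnW ik) // genmxE.
  by rewrite (eqmxMr _ (genmxE _)) -mulmxA gN mulmxA submxMfree.
have ranks i : (i <= k)%N ->
    [forall m : 'I_n, jfpart (flag_of g (inord i)) N m.+1 == tshape T i m.+1] =
    has_ranks (psum i) (rows i) M.
  move=> ik; rewrite (@forall_jfpart _ _ _ _ (rows i)); last first.
    by rewrite rows_sum // flag_rank // flag_of_flag.
  apply: eq_forallb => m; rewrite ffunE inordK // (eqmxMr _ (genmxE _)).
  by rewrite -mulmxA gNX mulmxA mxrankMfree.
apply/andP/(mem_shapes psum0 psum_mono rows0 _ (leqnn k)).
  case=> /forallP hc /forallP hr; rewrite psum_size pid_mx_1 mul1mx; split=> // i ik.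
    by rewrite -comp //; apply: (hc (Ordinal ik)).
  rewrite -ranks //; have := hr (inord i); rewrite inordK //.
case=> _ hc hr; split; apply/forallP => i.
  by rewrite comp // hc.
have ik : (i <= k)%N by rewrite -ltnS.
by have := ranks _ ik; rewrite hr // inord_val.
Qed.

Lemma card_fiber g : g \in unitmx ->
  #|[set p in pairs | p.1 == flag_of g]| = #|shapes F n psum rows k|.
Proof.
move=> gu; pose f M := (flag_of g, invmx g *m M *m g).
have fK : cancel f (fun p => g *m p.2 *m invmx g).
  by move=> M; rewrite /= !mulmxA mulmxV // mul1mx mulmxK.
rewrite -(card_imset _ (can_inj fK)); apply: eq_card => -[V N]; rewrite inE /=.
apply/andP/imsetP => [[pX /eqP eV]|[M MS [-> ->]]]; last by rewrite flag_of_pairs // eqxx.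
have eN : N = invmx g *m (g *m N *m invmx g) *m g.
  by rewrite !mulmxA mulVmx // mul1mx mulmxKV.
exists (g *m N *m invmx g); last by rewrite /f -eN eV.
by rewrite -(flag_of_pairs _ gu) -eN -eV.
Qed.

Lemma card_pairs :
  (#|pairs| * \prod_(i < k) \prod_(psum i <= t < psum i.+1) (#|F| ^ psum i.+1 - #|F| ^ t) =
   (\prod_(0 <= t < n) (#|F| ^ n - #|F| ^ t)) * #|shapes F n psum rows k|)%N.
Proof.
rewrite -card_unitmx -!sum_nat_const.
(* For a fixed pair the inner sum counts the frames adapted to its flag; after the exchange, a fixed
   [g] leaves a fibre as in [card_fiber]. *)
transitivity (\sum_(p in pairs) \sum_(g : 'M[F]_n | (g \in unitmx) && (flag_of g == p.1)) 1)%N.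
  apply: eq_bigr => p; rewrite inE => /and3P[fp _ _]; rewrite sum1_card.
  rewrite -(card_frames psum0 psum_mono psum_size (V := fun i => p.1 (inord i)) _ _ (leqnn k)).
  - by apply: eq_card => g; rewrite -flag_ofP.
  - by move=> i ik; have /andP[_ /forallP/(_ (Ordinal ik))] := fp.
  - by move=> i ik; apply: flag_rank.
rewrite (exchange_big_dep (fun g : 'M[F]_n => g \in unitmx)) /=; last by move=> p g _ /andP[].
rewrite [RHS](eq_bigl (fun g : 'M[F]_n => g \in unitmx)); last by move=> g; rewrite inE.
apply: eq_bigr => g gu; rewrite -(card_fiber gu) -sum1_card; apply: eq_bigl => p.
by rewrite inE gu eq_sym.
Qed.

End DoubleCount.

(** * Row lengths of the shapes in a semistandard tableau *)

Lemma ltn_count_sorted (s : seq nat) j c : sorted leq s ->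
  (c < count (fun x => x <= j) s)%N = (c < size s)%N && (nth 0%N s c <= j)%N.
Proof.
elim: s c => [|x s IH] c //= srt; have srt' := path_sorted srt.
have xs : all (leq x) s by apply: order_path_min srt; apply: leq_trans.
have [xj|jx] := leqP x j.
  by case: c => [|c] //=; rewrite add1n !ltnS IH.
rewrite add0n (_ : count _ _ = 0%N) ?ltn0; last first.
  apply/eqP; rewrite -leqn0 leqNgt -has_count; apply/hasPn => y ys.
  by rewrite -ltnNge (leq_trans jx) // (allP xs).
case: c => [|c] /=; first by rewrite leqNgt jx.
apply/esym/negP => /andP[cs]; rewrite leqNgt (leq_trans jx) //.
by apply: (allP xs); rewrite mem_nth.
Qed.

Lemma size_partition (la : seq nat) : is_partition la -> (size la <= sumn la)%N.
Proof.
by case/andP=> _; elim: la => //= x la IH /andP[x0 /IH]; lia.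
Qed.

Lemma sumn_nth (l : seq nat) m : (size l <= m)%N ->
  (\sum_(i < m) nth 0 l i = sumn l)%N.
Proof.
move=> lm; rewrite sumnE (big_nth 0%N) -(big_mkord xpredT (nth 0%N l)).
rewrite (@big_cat_nat _ _ _ (size l)) //= [X in (_ + X)%N]big_nat_cond [X in (_ + X)%N]big1 ?addn0 //.
by move=> i; rewrite andbT => /andP[h _]; rewrite nth_default.
Qed.

Section Tableau.
Variables (T : seq (seq nat)) (la alpha : seq nat).
Hypotheses (la_part : is_partition la) (T_ssyt : is_ssyt T la alpha).
Local Notation rows := (rows T).
Local Notation n := (sumn la).

Let size_T : size T = size la.
Proof. by case/and5P: T_ssyt => /eqP <- *; rewrite size_map. Qed.

Let size_row i : size (nth [::] T i) = nth 0%N la i.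
Proof.
case/and5P: T_ssyt => /eqP eT _ _ _ _; have [lt|ge] := ltnP i (size T).
  by rewrite -eT (nth_map [::]).
by rewrite !nth_default // -size_T.
Qed.

Let row_sorted i : sorted leq (nth [::] T i).
Proof.
case/and5P: T_ssyt => _ /allP h _ _ _; have [lt|ge] := ltnP i (size T).
  by apply/h/mem_nth.
by rewrite nth_default.
Qed.

Let row_entry i x : x \in nth [::] T i -> (0 < x <= size alpha)%N.
Proof.
case/and5P: T_ssyt => _ _ _ /allP h _; have [lt|ge] := ltnP i (size T).
  by move=> xT; apply: h; apply/flattenP; exists (nth [::] T i); rewrite ?mem_nth.
by rewrite nth_default.
Qed.

Lemma la_dec i : (nth 0 la i.+1 <= nth 0 la i)%N.
Proof.
have [lt|ge] := ltnP i.+1 (size la); last by rewrite nth_default.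
case/andP: la_part => srt _.
by apply: (sorted_ltn_nth (rev_trans leq_trans) 0%N srt); rewrite ?inE // ltnW.
Qed.

Lemma rows_ge j i : (size la <= i)%N -> rows j i = 0%N.
Proof. by move=> h; rewrite /rows /tshape nth_default // size_T. Qed.

Lemma rows_0 i : rows 0 i = 0%N.
Proof.
apply/eqP; rewrite -leqn0 leqNgt -has_count; apply/hasPn => x /row_entry/andP[x0 _].
by rewrite leqn0 -lt0n.
Qed.

Lemma rows_size i : rows (size alpha) i = nth 0%N la i.
Proof.
rewrite -size_row; apply/eqP; rewrite -all_count; apply/allP => x.
by case/row_entry/andP.
Qed.

Lemma rows_mono j i : (rows j i <= rows j.+1 i)%N.
Proof. by apply: sub_count => x /=; apply: leqW. Qed.

(** Consecutive shapes differ by a horizontal strip, because columns increase strictly: above an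
    entry at most [j+1] stands one at most [j]. *)
Lemma rows_strip j i : (rows j.+1 i.+1 <= rows j i)%N.
Proof.
rewrite leqNgt; apply/negP; rewrite /rows /tshape /= ltn_count_sorted //.
(* The column [c] is the first one of row [i] beyond the entries at most [j]; an entry at most [j+1]
   below it would put [c] among them. *)
set c := count _ _ => /andP[cs cj].
have : (c < c)%N; last by rewrite ltnn.
rewrite {2}/c ltn_count_sorted // size_row (leq_trans _ (la_dec i)) -?size_row //=.
have iT : (i < size T)%N.
  by rewrite ltnNge; apply: contraL cs => h; rewrite nth_default // leqW.
case/and5P: T_ssyt => _ _ /allP/(_ i) h _ _.
have /allP/(_ c) : all (fun c => nth 0 (nth [::] T i) c < nth 0 (nth [::] T i.+1) c)%N
    (iota 0 (size (nth [::] T i.+1))) by apply: h; rewrite mem_iota.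
by rewrite mem_iota => /(_ cs) /leq_trans/(_ cj); rewrite ltnS.
Qed.

Lemma rows_dec j i : (rows j i.+1 <= rows j i)%N.
Proof. exact: leq_trans (rows_mono _ _) (rows_strip _ _). Qed.

Lemma rows_tail j : (j <= size alpha)%N -> tail_sum n (rows j) 0 = psum alpha j.
Proof.
have row_sum (p : pred nat) : (\sum_(i < n) count p (nth [::] T i) = count p (flatten T))%N.
  rewrite count_flatten -(@sumn_nth (map (count p) T) n) ?size_map ?size_T ?size_partition //.
  apply: eq_bigr => i _; have [lt|ge] := ltnP i (size T).
    by rewrite (nth_map [::]).
  by rewrite !nth_default ?size_map.
elim: j => [|j IH] jk.
  rewrite psum0 /tail_sum big1_seq // => i _; exact: rows_0.
have rec i : rows j.+1 i = (rows j i + count_mem j.+1 (nth [::] T i))%N.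
  rewrite /rows /tshape -count_predUI [X in (_ + X)%N](_ : _ = 0%N) ?addn0.
    by apply: eq_count => x /=; rewrite leq_eqVlt orbC.
  by rewrite -(count_pred0 (nth [::] T i)); apply: eq_count => x /=; lia.
rewrite /tail_sum big_mkord; under eq_bigr do rewrite rec.
rewrite big_split /= (row_sum (pred1 j.+1)).
have := IH (ltnW jk); rewrite /tail_sum big_mkord => ->.
case/and5P: T_ssyt => _ _ _ _ /allP/(_ j) h.
rewrite (eqP (h _)) ?mem_iota //= /psum (take_nth 0%N) //.
by rewrite sumn_rcons.
Qed.

End Tableau.

(** * Products in [Q], Gaussian binomials in [q], and exponents *)

Lemma bin2S m : 'C(m.+1, 2) = ('C(m, 2) + m)%N.
Proof. by rewrite binS bin1. Qed.

Lemma bin2D u v : 'C(u + v, 2) = ('C(u, 2) + 'C(v, 2) + u * v)%N.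
Proof.
elim: u => [|u IH]; first by rewrite add0n bin0n mul0n addn0.
by rewrite addSn !bin2S IH mulSn; lia.
Qed.

Lemma bin2_rat (m : nat) : 'C(m, 2)%:R = m%:R * (m%:R - 1) / 2%:R :> rat.
Proof.
elim: m => [|m IH]; first by rewrite bin0n mulr0n !mul0r.
by rewrite bin2S natrD IH -natr1; field.
Qed.

Section Algebra.
Variable F : finFieldType.
Local Notation Q := (#|F|%:R : rat).
Local Notation P := (qprod F).
Local Notation q := (Q^-1).

Let Q_neq0 : Q != 0.
Proof. by rewrite pnatr_eq0 -lt0n (ltn_trans _ (card_field_gt1 F)). Qed.

Lemma q_neq1 : 1 - q != 0.
Proof.
by rewrite subr_eq0 eq_sym invr_eq1 pnatr_eq1 gtn_eqF // card_field_gt1.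
Qed.

Lemma qfactS m : qfact q m.+1 = qfact q m * qint q m.+1.
Proof. by rewrite /qfact big_nat_recr. Qed.

Lemma qprod_qfact m : P m = qfact q m * Q ^+ 'C(m.+1, 2) * (1 - q) ^+ m.
Proof.
elim: m => [|m IH]; first by rewrite /qprod /qfact !big_geq // !mulr1.
rewrite qprodS IH qfactS [_ ^+ m.+1 in RHS]exprSr (bin2S m.+1) exprD.
have -> : Q ^+ m.+1 - 1 = qint q m.+1 * (1 - q) * Q ^+ m.+1.
  rewrite /qint -[_ * (1 - q)]opprK -mulrN opprB [_ * (q - 1)]mulrC -subrX1 opprB.
  by rewrite mulrBl mul1r -exprMn mulVf // expr1n.
ring.
Qed.

Lemma qfact_neq0 m : qfact q m != 0.
Proof.
by have := qprod_neq0 F m; rewrite qprod_qfact !mulf_eq0 !negb_or => /andP[/andP[]].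
Qed.

(** The Gaussian binomials at [Q] and at its inverse [q] differ by the factor [Q ^+ (u * v)]. *)
Lemma qprod_binom u v :
  P (u + v) = P u * P v * qbinom q (u + v) u * Q ^+ (u * v).
Proof.
rewrite !qprod_qfact /qbinom addKn.
have -> : 'C((u + v).+1, 2) = ('C(u.+1, 2) + 'C(v.+1, 2) + u * v)%N.
  by rewrite (bin2S (u + v)) (bin2S u) (bin2S v) bin2D; lia.
by rewrite !exprD; field; rewrite !qfact_neq0.
Qed.

(** The left side is the number of injective linear maps from dimension [x] to dimension [y]. Taking
    [Q ^+ t] out of each factor leaves the top [x] factors of [P y]. *)
Lemma inj_weight y x : (x <= y)%N ->
  \prod_(t < x) (Q ^+ y - Q ^+ t) = Q ^+ 'C(x, 2) * P y / P (y - x).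
Proof.
elim: x => [|x IH] xy; first by rewrite big_ord0 subn0 mul1r divff // qprod_neq0.
have [d ey] : exists d, y = (d.+1 + x)%N by exists (y - x.+1)%N; lia.
rewrite (bin2S x) exprD big_ord_recr /= IH ?(ltnW xy) // ey addnK.
rewrite (_ : (d.+1 + x - x.+1 = d)%N) ?qprodS; last by lia.
rewrite [Q ^+ (d.+1 + x)]exprD; set z := Q ^+ d.+1.
have z1 : z - 1 != 0 by apply: qpow_sub1_neq0.
by field; rewrite qprod_neq0 z1.
Qed.

(** The powers [Q ^+ t] are kept apart: over all blocks they multiply to those in the order of the
    general linear group and cancel. *)
Lemma prod_subX_qprod (s r : nat) : (s <= r)%N ->
  (\prod_(s <= t < r) (#|F| ^ r - #|F| ^ t))%N%:R =
  (\prod_(s <= t < r) Q ^+ t) * P (r - s).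
Proof.
elim: {s}(r - s)%N {-2}s (erefl (r - s)%N) => [|d IH] s.
  by move=> e sr; rewrite (_ : s = r) ?big_geq ?mul1r // ?/qprod ?big_geq //; lia.
move=> e sr; have lt : (s < r)%N by lia.
rewrite !(big_ltn lt) natrM IH //; last by lia.
rewrite natrB ?leq_pexp2l ?(ltnW (card_field_gt1 _)) // !natrX e.
rewrite (_ : (r - s.+1 = d)%N) ?qprodS; last by lia.
rewrite (_ : Q ^+ r = Q ^+ s * Q ^+ d.+1); last by rewrite -exprD; congr (_ ^+ _); lia.
ring.
Qed.

Section Step.
Variable n : nat.
Local Notation tail_sum := (tail_sum n).

(* Up to the binomials of the parts of [alpha], the total exponent of [Q] in the
   weights of the chains of shapes from the empty one to [l], once the Gaussian
   binomials are rewritten in terms of [q]. *)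
Definition psi (s : nat) (l : nat -> nat) : int :=
  (s * s)%N%:Z - s%:Z - 'C(s.+1, 2)%:Z - (\sum_(i < n) 'C(l i, 2))%N%:Z
  + (\sum_(i < n) 'C((l i - l i.+1).+1, 2))%N%:Z.

Let c2 (x : rat) : rat := x * (x - 1) / 2%:R.

Lemma psiE s (l : nat -> nat) : (forall i, (l i.+1 <= l i)%N) ->
  (psi s l)%:~R = s%:R * s%:R - s%:R - c2 (s%:R + 1) - \sum_(i < n) c2 (l i)%:R
    + \sum_(i < n) c2 ((l i)%:R - (l i.+1)%:R + 1).
Proof.
move=> l_dec; rewrite /psi !(intrD, mulrNz) -!pmulrn natrM bin2_rat natr1.
rewrite !natr_sum; congr (_ - _ + _); apply: eq_bigr => i _;
  by rewrite bin2_rat // -natr1 natrB.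
Qed.

(** A potential on shapes: its quotient over a step is the row weight of the step, up to
    [strip_weight] and a power of [Q] depending on the sizes only. *)
Definition theta (s : nat) (l : nat -> nat) : rat :=
  Q ^ psi s l / \prod_(i < n) P (l i - l i.+1).

Variables (s s' : nat) (mu la : nat -> nat).
Hypotheses (mu_la : forall i, (mu i <= la i)%N) (strip : forall i, (la i.+1 <= mu i)%N).
Hypotheses (la_n : la n = 0%N) (mu_s : tail_sum mu 0 = s) (la_s : tail_sum la 0 = s').

Let mu_n : mu n = 0%N. Proof. by have := mu_la n; lia. Qed.

(** The three terms come from [inj_weight] (nothing in row 0), from the explicit power in
    [row_weight], and from [qprod_binom]. *)
Definition step_exp : nat :=
  (\sum_(i < n) ((if (i : nat) is 0 then 0 else 'C(la i - mu i, 2))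
     + (la i - mu i) * (s - mu i.-1) + (la i - mu i) * (mu i - la i.+1)))%N.

Lemma psi_step : psi s' la = psi s mu + ('C(s' - s, 2) + step_exp)%N%:Z.
Proof.
have mu_le i : (i < n)%N -> (mu i <= s)%N.
  move=> lt; rewrite -mu_s /tail_sum (@big_cat_nat _ _ _ i 0 n) ?(ltnW lt) //=.
  by rewrite (big_ltn lt); lia.
pose m i : rat := (mu i)%:R; pose l i : rat := (la i)%:R.
have ss : (s <= s')%N.
  by rewrite -mu_s -la_s; apply: leq_sum => i _; apply: mu_la.
have sE : s%:R = \sum_(i < n) m i by rewrite -mu_s /tail_sum big_mkord natr_sum.
have s'E : s'%:R = \sum_(i < n) l i by rewrite -la_s /tail_sum big_mkord natr_sum.
(* The two sums do not agree row by row. The last line is the discrepancy of the partial sums, found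
   by telescoping; at [h = n-1] it vanishes as both shapes are 0 at [n]. *)
have key h : (h < n)%N ->
   \sum_(i < h.+1) ((l i - m i) * (s%:R - 1) - (c2 (l i) - c2 (m i))
       + (c2 (l i - l i.+1 + 1) - c2 (m i - m i.+1 + 1)))
   = \sum_(i < h.+1) ((if (i : nat) is 0 then 0 else c2 (l i - m i))
     + (l i - m i) * (s%:R - m i.-1) + (l i - m i) * (m i - l i.+1))
   + (c2 (l h.+1) - c2 (m h.+1) - m h * (l h.+1 - m h.+1)).
  elim: h => [|h IH] hn; first by rewrite !big_ord1 /= /c2; field.
  by rewrite big_ord_recr [in RHS]big_ord_recr IH ?(ltnW hn) //= /c2; field.
have step_expE : step_exp%:R = \sum_(i < n)
    ((if (i : nat) is 0 then 0 else c2 (l i - m i))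
     + (l i - m i) * (s%:R - m i.-1) + (l i - m i) * (m i - l i.+1)) :> rat.
  rewrite natr_sum; apply: eq_bigr => i _; rewrite !natrD !natrM !natrB //; last first.
    by apply: mu_le; rewrite (leq_ltn_trans (leq_pred _)).
  congr (_ + _ + _); case: (nat_of_ord i) => // j.
  by rewrite bin2_rat natrB.
apply/eqP; rewrite -(eqr_int rat) intrD !psiE; first last.
- by move=> i; apply: leq_trans (strip i) (mu_la i).
- by move=> i; apply: leq_trans (mu_la i.+1) (strip i).
rewrite -pmulrn natrD bin2_rat natrB // step_expE -!/(l _) -!/(m _).
apply/eqP.
have {}key : \sum_(i < n) ((l i - m i) * (s%:R - 1) - (c2 (l i) - c2 (m i))
       + (c2 (l i - l i.+1 + 1) - c2 (m i - m i.+1 + 1)))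
   = \sum_(i < n) ((if (i : nat) is 0 then 0 else c2 (l i - m i))
     + (l i - m i) * (s%:R - m i.-1) + (l i - m i) * (m i - l i.+1)).
  have [n0|/prednK en] := posnP n; first by rewrite n0 !big_ord0.
  rewrite -[in LHS]en -[in RHS]en key ?en //.
  by rewrite /l /m la_n mu_n !mulr0n /c2; ring.
have lin : \sum_(i < n) (l i - m i) * (s%:R - 1) = (s'%:R - s%:R) * (s%:R - 1).
  by rewrite -mulr_suml sumrB -sE -s'E.
by rewrite -key big_split /= sumrB lin !sumrB /l /m /c2; field.
Qed.

Definition strip_weight : rat := \prod_(i < n) qbinom q (la i - la i.+1) (la i - mu i).

Lemma prod_row_weight :
  (\prod_(i < n) row_weight F s mu i (la i - mu i)) * theta s mu * Q ^+ 'C(s' - s, 2) =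
  theta s' la * strip_weight.
Proof.
pose f i : rat := P (mu i - mu i.+1) / P (mu i - la i.+1).
have f0 i : f i != 0 by rewrite mulf_neq0 ?invr_eq0 ?qprod_neq0.
(* The weight of a row involves the row above it, the binomials the row below. The shift costs
   nothing since the last factor [f n.-1] is 1. *)
have shift : \prod_(i < n) (if (i : nat) is i'.+1 then f i' else 1) = \prod_(i < n) f i.
  have [n0|n0] := posnP n; first by rewrite n0 !big_ord0.
  rewrite -[in LHS](prednK n0) big_ord_recl mul1r -[in RHS](prednK n0) big_ord_recr /=.
  by rewrite /f prednK // la_n mu_n divff ?qprod_neq0 ?mulr1.
have rw (i : 'I_n) : row_weight F s mu i (la i - mu i) =
   (if (i : nat) is i'.+1 then f i' else 1) / P (la i - mu i) *
   Q ^+ ((if (i : nat) is 0 then 0 else 'C(la i - mu i, 2))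
     + (la i - mu i) * (s - mu i.-1)).
  rewrite /row_weight; case: (nat_of_ord i) => [|j] /=.
    by rewrite add0n !mul1r mulrC.
  have h1 := mu_la j.+1; have h2 := strip j.
  rewrite inj_weight ?leq_sub2r // exprD /f.
  rewrite (_ : (mu j - mu j.+1 - (la j.+1 - mu j.+1) = mu j - la j.+1)%N); last by lia.
  by rewrite -!mulrA; ring.
have wt (i : 'I_n) : qbinom q (la i - la i.+1) (la i - mu i) *
    Q ^+ ((la i - mu i) * (mu i - la i.+1)) / P (la i - la i.+1) =
    f i / P (la i - mu i) / P (mu i - mu i.+1).
  have h1 := mu_la i; have h2 := strip i.
  rewrite /f (_ : (la i - la i.+1 = (la i - mu i) + (mu i - la i.+1))%N); last by lia.
  rewrite qprod_binom; field; rewrite !qprod_neq0 /=.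
  by rewrite expf_neq0 // mulf_neq0 ?invr_eq0 ?mulf_neq0 ?qfact_neq0.
have expE : Q ^ psi s' la = Q ^ psi s mu * Q ^+ 'C(s' - s, 2) *
    \prod_(i < n) (Q ^+ ((if (i : nat) is 0 then 0 else 'C(la i - mu i, 2))
     + (la i - mu i) * (s - mu i.-1)) * Q ^+ ((la i - mu i) * (mu i - la i.+1))).
  rewrite psi_step expfzDr // -exprnP exprD mulrA; congr (_ * _).
  by rewrite /step_exp expr_sum; apply: eq_bigr => i _; rewrite exprD.
have e : \prod_(i < n) qbinom q (la i - la i.+1) (la i - mu i) *
    \prod_(i < n) Q ^+ ((la i - mu i) * (mu i - la i.+1)) / \prod_(i < n) P (la i - la i.+1) =
    \prod_(i < n) f i / \prod_(i < n) P (la i - mu i) / \prod_(i < n) P (mu i - mu i.+1).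
  by rewrite -!prodfV -!big_split /=; apply: eq_bigr => i _; apply: wt.
rewrite /theta /strip_weight expE (eq_bigr _ (fun i _ => rw i)).
move: e shift; set Z := \prod_(i < n) qbinom _ _ _; set A := \prod_(i < n) f i.
move=> e shift; rewrite !big_split /= !prodfV shift {shift}; move: A Z e => A Z.
move: (\prod_(i < n) P (la i - mu i)) => B.
move: (\prod_(i < n) P (mu i - mu i.+1)) (\prod_(i < n) P (la i - la i.+1)) => D D'.
move: (\prod_(i < n) Q ^+ (_ * (mu _ - _))) => Wd.
move: (\prod_(i < n) Q ^+ _) => Wc e.
transitivity (Q ^ psi s mu * Q ^+ 'C(s' - s, 2) * Wc * (Z * Wd / D')); last by ring.
by rewrite e; ring.
Qed.

End Step.
End Algebra.

(** * Assembly of the closed formula *)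

Section Total.
Variables (F : finFieldType) (alpha la : seq nat) (T : seq (seq nat)).
Hypotheses (la_part : is_partition la) (T_ssyt : is_ssyt T la alpha).
Hypothesis alpha_la : sumn alpha = sumn la.
Local Notation n := (sumn la).
Local Notation k := (size alpha).
Local Notation Q := (#|F|%:R : rat).
Local Notation P := (qprod F).
Local Notation q := (Q^-1).
Local Notation rows := (rows T).
Local Notation s := (psum alpha).

Let Q_neq0 : Q != 0.
Proof. by rewrite pnatr_eq0 -lt0n (ltn_trans _ (card_field_gt1 F)). Qed.

Let rowsn j : rows j n = 0%N.
Proof. by rewrite (rows_ge T_ssyt) // size_partition. Qed.

Lemma psumS i : (i < k)%N -> s i.+1 = (s i + nth 0 alpha i)%N.
Proof. by move=> ik; rewrite /psum (take_nth 0%N) // sumn_rcons. Qed.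

Lemma theta_rows0 : theta F n 0 (rows 0) = 1.
Proof.
rewrite /theta /psi.
have -> : (\sum_(i < n) 'C(rows 0 i, 2) = 0)%N by apply: big1 => i _; rewrite (rows_0 T_ssyt).
have -> : (\sum_(i < n) 'C((rows 0 i - rows 0 i.+1).+1, 2) = 0)%N.
  by apply: big1 => i _; rewrite !(rows_0 T_ssyt).
by rewrite big1 ?divr1 // => i _; rewrite !(rows_0 T_ssyt) /qprod big_geq.
Qed.

Lemma prod_rows_weight j : (j <= k)%N ->
  (\prod_(i < j) \prod_(t < n) row_weight F (s i) (rows i) t (rows i.+1 t - rows i t))
    * Q ^+ (\sum_(i < j) 'C(nth 0 alpha i, 2)) =
  theta F n (s j) (rows j) * \prod_(i < j) strip_weight F n (rows i) (rows i.+1).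
Proof.
elim: j => [|j IH] jk; first by rewrite !big_ord0 psum0 theta_rows0.
rewrite 2!big_ord_recr exprD [in RHS]big_ord_recr /= mulrACA IH ?(ltnW jk) //.
have := @prod_row_weight F n (s j) (s j.+1) (rows j) (rows j.+1)
  (rows_mono _ _) (rows_strip la_part T_ssyt _) (rowsn _)
  (rows_tail la_part T_ssyt (ltnW jk)) (rows_tail la_part T_ssyt jk).
rewrite [in 'C(_ - _, _)]psumS // addKn => e.
by rewrite mulrAC [X in _ = X]mulrA [X in _ = X * _]mulrC -[X in _ = X]mulrA -e; ring.
Qed.

Lemma prod_prod_psum (f : nat -> rat) j :
  \prod_(i < j) \prod_(s i <= t < s i.+1) f t = \prod_(0 <= t < s j) f t.
Proof.
elim: j => [|j IH]; first by rewrite big_ord0 psum0 big_geq.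
by rewrite big_ord_recr /= IH -big_cat_nat // psum_mono.
Qed.

(** Dividing the double count by the adapted frames cancels the powers [A] and also [B], which
    occurs both in the frames and in the count of the shapes. *)
Lemma card_pairs_weight :
  #|pairs F n alpha T|%:R =
  P n * \prod_(i < k) \prod_(t < n) row_weight F (s i) (rows i) t (rows i.+1 t - rows i t).
Proof.
have sm i : (s i <= s i.+1)%N by apply: psum_mono.
have := card_pairs F alpha_la (rows_0 T_ssyt) (fun j => @rows_tail T la alpha la_part T_ssyt j).
move/(congr1 (fun m => m%:R : rat)); rewrite !natrM.
rewrite (@card_shapes F n k s (psum0 _) (@psum_mono _) (psum_size alpha_la) rows
  (rows_0 T_ssyt) (fun j i _ => rows_dec la_part T_ssyt j i)
  (fun j i _ => rows_mono T j i) (fun j => @rows_tail T la alpha la_part T_ssyt j) k (leqnn k)).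
rewrite (prod_subX_qprod F (leq0n n)) subn0 natr_prod big_split /=.
rewrite (eq_bigr _ (fun (i : 'I_k) _ => prod_subX_qprod F (sm i))) big_split /=.
rewrite prod_prod_psum (psum_size alpha_la).
set A := \prod_(0 <= t < n) _; set B := \prod_(i < k) P _; set W := \prod_(i < k) \prod_(t < n) _.
have A0 : A != 0 by rewrite /A big_mkord; apply/prodf_neq0 => t _; apply: expf_neq0.
have B0 : B != 0 by apply/prodf_neq0 => t _; apply: qprod_neq0.
have AB : A * B != 0 by rewrite mulf_neq0.
by move=> e; apply: (mulIf AB); rewrite e; ring.
Qed.

Lemma wtE : wt q T k n = \prod_(i < k) strip_weight F n (rows i) (rows i.+1).
Proof.
rewrite /wt big_add1 big_mkord; apply: eq_bigr => j _.
by rewrite big_add1 big_mkord.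
Qed.

Lemma nstatE (l : seq nat) m : (size l <= m)%N ->
  nstat l = (\sum_(i < m) 'C(nth 0 l i, 2))%N.
Proof.
move=> lm; rewrite /nstat -(big_map (fun x => 'C(x, 2)) xpredT id) -sumnE.
rewrite -(@sumn_nth _ m) ?size_map //; apply: eq_bigr => i _.
have [lt|ge] := ltnP i (size l); first by rewrite (nth_map 0%N).
by rewrite !nth_default ?size_map.
Qed.

Lemma card_pairs_formula : #|pairs F n alpha T|%:R = formula q n la alpha T.
Proof.
have rowsE i : rows k i = nth 0%N la i := rows_size T_ssyt i.
pose b i := (nth 0 la i - nth 0 la i.+1)%N.
(* The telescoping shows that the denominators carry [1 - q] to the power of the first part of [la],
   whence the exponent [n - nth 0 la 0]. *)
have sum_b m : (\sum_(i < m) b i + nth 0 la m = nth 0 la 0)%N.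
  elim: m => [|m IH]; first by rewrite big_ord0.
  by rewrite big_ord_recr /= /b -addnA subnK // la_dec.
have la_n : nth 0%N la n = 0%N by rewrite -rowsE rowsn.
have la0 : (nth 0 la 0 <= n)%N.
  by case: (la) => //= x l; apply: leq_addr.
have D : \prod_(i < n) P (rows k i - rows k i.+1) =
    \prod_(i < n) qfact q (b i) * Q ^+ (\sum_(i < n) 'C((b i).+1, 2)) * (1 - q) ^+ nth 0%N la 0.
  rewrite -(sum_b n) la_n addn0 !expr_sum -!big_split /=.
  by apply: eq_bigr => i _; rewrite !rowsE qprod_qfact.
have psi_n : psi n n (rows k) = (n * n)%N%:Z - n%:Z - 'C(n.+1, 2)%:Z - (nstat la)%:Z
    + (\sum_(i < n) 'C((b i).+1, 2))%N%:Z.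
  rewrite (nstatE (size_partition la_part)) /psi.
  by congr (_ - Posz _ + Posz _); apply: eq_bigr => i _; rewrite !rowsE.
have expE : Q ^ psi n n (rows k) * Q ^+ 'C(n.+1, 2) =
    q ^ (- (n * n)%N%:Z + (n + nstat la + nstat alpha)%N%:Z) * Q ^+ nstat alpha *
    Q ^+ (\sum_(i < n) 'C((b i).+1, 2)).
  rewrite exprz_inv !exprnP -!expfzDr // psi_n !PoszD; congr (_ ^ _); ring.
have := prod_rows_weight (leqnn k); have := card_pairs_weight.
rewrite -wtE (psum_size alpha_la) -(nstatE (leqnn k)) => -> e.
have Qa0 : Q ^+ nstat alpha != 0 by apply: expf_neq0.
apply: (mulIf Qa0); rewrite -mulrA e {e} mulrA /theta /formula D qprod_qfact.
have -> : (1 - q) ^+ n = (1 - q) ^+ (n - nth 0 la 0) * (1 - q) ^+ nth 0%N la 0.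
  by rewrite -exprD subnK.
have q1 : (1 - q) ^+ nth 0%N la 0 != 0 by apply/expf_neq0/q_neq1.
have Qc0 : Q ^+ (\sum_(i < n) 'C((b i).+1, 2)) != 0 by apply: expf_neq0.
have B0 : \prod_(i < n) qfact q (b i) != 0 by apply/prodf_neq0 => i _; apply: qfact_neq0.
rewrite -/(b _); under [in RHS]eq_bigr do rewrite -/(b _).
move: (\prod_(i < n) qfact q (b i)) (Q ^+ (\sum_(i < n) _)) expE Qc0 B0 => B Qc expE Qc0 B0.
transitivity (Q ^ psi n n (rows k) * Q ^+ 'C(n.+1, 2) * qfact q n *
  (1 - q) ^+ (n - nth 0%N la 0) / B / Qc * wt q T k n).
  by move: (_ ^ psi _ _ _) ((1 - q) ^+ _) q1 => x y q1; field; rewrite q1 Qc0 B0.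
rewrite expE; move: (q ^ _) => x; field; by rewrite Qc0 B0.
Qed.

End Total.

Theorem theorem9p6 (F : finFieldType) (Q n : nat) (alpha la : seq nat)
    (T : seq (seq nat)) :
  #|F| = Q ->
  sumn alpha = n ->
  is_partition la -> sumn la = n ->
  is_ssyt T la alpha ->
  (count_pairs F n alpha T)%:R = formula (Q%:R)^-1 n la alpha T :> rat.
Proof.
move=> <- alpha_n la_part la_n T_ssyt; rewrite -la_n in alpha_n *.
exact: card_pairs_formula.
Qed.
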